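(* Let $A$ be an $n\times n$ bicomplex matrix, written in its idempotent representation as $A=A_1\mathbf{e}_1+A_2\mathbf{e}_2$ with $A_1,A_2$ complex $n\times n$ matrices. Put $A_1$ and $A_2$ in (complex) Jordan form as $A_1=P_1J_1P_1^{-1}$ and $A_2=P_2J_2P_2^{-1}$. Then a (bicomplex) Jordan form of $A$ is $A=PJP^{-1}$, where $P=P_1\mathbf{e}_1+P_2\mathbf{e}_2$ and $J=J_1\mathbf{e}_1+J_2\mathbf{e}_2$. Because the Jordan forms of $A_1$ and $A_2$ are not unique (for example, the diagonal blocks of $J_1$ and $J_2$ may appear in any order), this Jordan form representation of $A$ can take on many different forms.
   Context: The bicomplex numbers $\mathbb{BC}$ are the elements $\zeta=z_1+jz_2$ with $z_1,z_2\in\mathbb{C}$, $i^2=j^2=-1$, $ij=ji$; they form a commutative ring. Put $\mathbf{e}_1=(1+ij)/2$ and $\mathbf{e}_2=(1-ij)/2$; then $\mathbf{e}_1^2=\mathbf{e}_1$, $\mathbf{e}_2^2=\mathbf{e}_2$, $\mathbf{e}_1\mathbf{e}_2=0$. Every $\zeta\in\mathbb{BC}$ has a unique idempotent representation $\zeta=\zeta_1\mathbf{e}_1+\zeta_2\mathbf{e}_2$ with $\zeta_1=z_1-iz_2$ and $\zeta_2=z_1+iz_2$ in $\mathbb{C}$. Writing each entry of a bicomplex matrix $A$ in idempotent representation gives $A=A_1\mathbf{e}_1+A_2\mathbf{e}_2$ with $A_1,A_2$ complex matrices. Products of bicomplex matrices are the usual row-times-column products, and $P^{-1}$ denotes the inverse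 over $\mathbb{BC}$. A bicomplex Jordan form of $A$ means a factorization $A=PJP^{-1}$ with $P$ an invertible bicomplex matrix and $J=J_1\mathbf{e}_1+J_2\mathbf{e}_2$ where $J_1,J_2$ are complex Jordan form matrices. *)

(* Defs.v *)
From HB Require Import structures.
From mathcomp Require Import all_boot all_order all_algebra.
From mathcomp Require Import reals complex.
From mathcomp Require Import ring.

Set Implicit Arguments.
Unset Strict Implicit.
Unset Printing Implicit Defensive.

Import Order.TTheory GRing.Theory Num.Theory.
Local Open Scope ring_scope.

(* Bicomplex z1 z2 is z1 + j z2. *)
Record bicomplex (R : realType) : Type :=
  Bicomplex { bc_fst : R[i]; bc_snd : R[i] }.

Section BicomplexRing.
Variable R : realType.
Implicit Types x y z : bicomplex R.

Definition pair_of_bc x := (bc_fst x, bc_snd x).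
Definition bc_of_pair (p : R[i] * R[i]) := Bicomplex p.1 p.2.

Lemma pair_of_bcK : cancel pair_of_bc bc_of_pair.
Proof. by case. Qed.

HB.instance Definition _ := Choice.copy (bicomplex R) (can_type pair_of_bcK).

Lemma bc_eqP x y :
  bc_fst x = bc_fst y -> bc_snd x = bc_snd y -> x = y.
Proof. by case: x y => [a b] [c d] /= -> ->. Qed.

Definition bc_zero : bicomplex R := Bicomplex 0 0.
Definition bc_one : bicomplex R := Bicomplex 1 0.
Definition bc_opp x := Bicomplex (- bc_fst x) (- bc_snd x).
Definition bc_add x y :=
  Bicomplex (bc_fst x + bc_fst y) (bc_snd x + bc_snd y).
Definition bc_mul x y :=
  Bicomplex (bc_fst x * bc_fst y - bc_snd x * bc_snd y)
            (bc_fst x * bc_snd y + bc_snd x * bc_fst y).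

Lemma bc_addA : associative bc_add.
Proof. by move=> x y z; apply: bc_eqP; rewrite /= addrA. Qed.
Lemma bc_addC : commutative bc_add.
Proof. by move=> x y; apply: bc_eqP; rewrite /= addrC. Qed.
Lemma bc_add0 : left_id bc_zero bc_add.
Proof. by move=> x; apply: bc_eqP; rewrite /= add0r. Qed.
Lemma bc_addN : left_inverse bc_zero bc_opp bc_add.
Proof. by move=> x; apply: bc_eqP; rewrite /= addNr. Qed.

HB.instance Definition _ :=
  GRing.isZmodule.Build (bicomplex R) bc_addA bc_addC bc_add0 bc_addN.

Lemma bc_mulA : associative bc_mul.
Proof. by move=> x y z; apply: bc_eqP => /=; ring. Qed.
Lemma bc_mulC : commutative bc_mul.
Proof. by move=> x y; apply: bc_eqP => /=; ring. Qed.
Lemma bc_mul1 : left_id bc_one bc_mul.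
Proof. by move=> x; apply: bc_eqP => /=; ring. Qed.
Lemma bc_mulD : left_distributive bc_mul bc_add.
Proof. by move=> x y z; apply: bc_eqP => /=; ring. Qed.
Lemma bc_one_neq0 : bc_one != bc_zero.
Proof. by apply/eqP => -[] /eqP; rewrite oner_eq0. Qed.

HB.instance Definition _ := GRing.Zmodule_isComNzRing.Build (bicomplex R)
  bc_mulA bc_mulC bc_mul1 bc_mulD bc_one_neq0.

(* (z1 + j z2) (z1 - j z2) = z1^2 + z2^2 *)
Definition bc_normsq x : R[i] := bc_fst x ^+ 2 + bc_snd x ^+ 2.
Definition bc_unit : pred (bicomplex R) := fun x => bc_normsq x != 0.
Definition bc_inv x :=
  if bc_unit x
  then Bicomplex (bc_fst x / bc_normsq x) (- bc_snd x / bc_normsq x)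
  else x.

Lemma bc_mulV : {in bc_unit, left_inverse 1 bc_inv *%R}.
Proof.
move=> x ux; rewrite /bc_inv ifT //.
have {}ux : bc_fst x ^+ 2 + bc_snd x ^+ 2 != 0 by [].
rewrite /bc_normsq; apply: bc_eqP => /=; field; exact: ux.
Qed.
Lemma bc_unitP x y : y * x = 1 -> bc_unit x.
Proof.
case: x y => [a b] [c d] [h1 h2]; apply/negP => /eqP; rewrite /bc_normsq /= => h.
have : (c ^+ 2 + d ^+ 2) * (a ^+ 2 + b ^+ 2)
       = (c * a - d * b) ^+ 2 + (c * b + d * a) ^+ 2 by ring.
by rewrite h mulr0 h1 h2 expr1n expr0n addr0 => /esym/eqP; rewrite oner_eq0.
Qed.
Lemma bc_inv_out : {in [predC bc_unit], bc_inv =1 id}.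
Proof. by move=> x nux; rewrite /bc_inv ifN. Qed.

HB.instance Definition _ := GRing.ComNzRing_hasMulInverse.Build (bicomplex R)
  bc_mulV bc_unitP bc_inv_out.

End BicomplexRing.

Definition bcC (R : realType) (z : R[i]) : bicomplex R := Bicomplex z 0.
Definition bc_i (R : realType) : bicomplex R := bcC 'i%C.
Definition bc_j (R : realType) : bicomplex R := Bicomplex 0 1.
Definition bc_e1 (R : realType) : bicomplex R := (1 + bc_i R * bc_j R) / 2%:R.
Definition bc_e2 (R : realType) : bicomplex R := (1 - bc_i R * bc_j R) / 2%:R.

Definition bc_idem1 (R : realType) (x : bicomplex R) : R[i] :=
  bc_fst x - 'i%C * bc_snd x.
Definition bc_idem2 (R : realType) (x : bicomplex R) : R[i] :=
  bc_fst x + 'i%C * bc_snd x.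

Definition idem_mx (R : realType) (m n : nat) (A1 A2 : 'M[R[i]]_(m, n)) :
    'M[bicomplex R]_(m, n) :=
  bc_e1 R *: map_mx (@bcC R) A1 + bc_e2 R *: map_mx (@bcC R) A2.

Section Idempotents.
Variable R : realType.

Lemma bc_jj : bc_j R * bc_j R = -1.
Proof. by apply: bc_eqP; rewrite /= ?(mul0r, mulr0, mulr1, oppr0, addr0, sub0r). Qed.

Lemma bc_e1E : bc_e1 R = Bicomplex 2%:R^-1 ('i%C / 2%:R).
Proof.
have n2 : (2%:R : R[i]) != 0 by rewrite pnatr_eq0.
have e2 : (2%:R : bicomplex R) = Bicomplex 2%:R 0.
  by apply: bc_eqP; rewrite /= ?addr0.
have u2 : (2%:R : bicomplex R) \is a GRing.unit.
  by rewrite e2 qualifE /= /bc_unit /bc_normsq /= expr0n addr0 expf_neq0.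
apply: (mulIr u2); rewrite divrK // e2.
by apply: bc_eqP => /=; field.
Qed.

Lemma bc_e2E : bc_e2 R = Bicomplex 2%:R^-1 (- 'i%C / 2%:R).
Proof.
have n2 : (2%:R : R[i]) != 0 by rewrite pnatr_eq0.
have e2 : (2%:R : bicomplex R) = Bicomplex 2%:R 0.
  by apply: bc_eqP; rewrite /= ?addr0.
have u2 : (2%:R : bicomplex R) \is a GRing.unit.
  by rewrite e2 qualifE /= /bc_unit /bc_normsq /= expr0n addr0 expf_neq0.
apply: (mulIr u2); rewrite divrK // e2.
by apply: bc_eqP => /=; field.
Qed.

Lemma bc_idemK1 (a b : R[i]) :
  bc_idem1 (bc_e1 R * bcC a + bc_e2 R * bcC b) = a.
Proof.
have ii : ('i%C : R[i]) ^+ 2 = -1 by rewrite sqr_i.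
have n2 : (2%:R : R[i]) != 0 by rewrite pnatr_eq0.
by rewrite bc_e1E bc_e2E /bc_idem1 /=; field: ii.
Qed.

Lemma bc_idemK2 (a b : R[i]) :
  bc_idem2 (bc_e1 R * bcC a + bc_e2 R * bcC b) = b.
Proof.
have ii : ('i%C : R[i]) ^+ 2 = -1 by rewrite sqr_i.
have n2 : (2%:R : R[i]) != 0 by rewrite pnatr_eq0.
by rewrite bc_e1E bc_e2E /bc_idem2 /=; field: ii.
Qed.

Lemma bc_idemE (x : bicomplex R) :
  x = bc_e1 R * bcC (bc_idem1 x) + bc_e2 R * bcC (bc_idem2 x).
Proof.
have ii : ('i%C : R[i]) ^+ 2 = -1 by rewrite sqr_i.
have n2 : (2%:R : R[i]) != 0 by rewrite pnatr_eq0.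
rewrite bc_e1E bc_e2E /bc_idem1 /bc_idem2; apply: bc_eqP => /=; field: ii => //.
Qed.

Lemma idem_mxE (m n : nat) (A : 'M[bicomplex R]_(m, n)) :
  A = idem_mx (map_mx (@bc_idem1 R) A) (map_mx (@bc_idem2 R) A).
Proof. by apply/matrixP => i j; rewrite !mxE -bc_idemE. Qed.

Lemma idem_mx_inj (m n : nat) (A1 A2 B1 B2 : 'M[R[i]]_(m, n)) :
  idem_mx A1 A2 = idem_mx B1 B2 -> A1 = B1 /\ A2 = B2.
Proof.
move=> /matrixP E; split; apply/matrixP => i j; move: (E i j); rewrite !mxE.
  by move=> /(congr1 (@bc_idem1 R)); rewrite !bc_idemK1.
by move=> /(congr1 (@bc_idem2 R)); rewrite !bc_idemK2.
Qed.

End Idempotents.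

Section Jordan.
Variable F : fieldType.

Definition jordan_block (a : F) (k : nat) : 'M[F]_k :=
  \matrix_(i, j) (if i == j then a else (i.+1 == j :> nat)%:R).

(* The list s gives, in order, the (eigenvalue, size) pairs of the blocks. *)
Fixpoint jordan_mx (s : seq (F * nat)) : 'M[F]_(sumn [seq b.2 | b <- s]) :=
  match s return 'M[F]_(sumn [seq b.2 | b <- s]) with
  | [::] => 0
  | b :: s' => block_mx (jordan_block b.1 b.2) 0 0 (jordan_mx s')
  end.

(* Blocks of size 0 are excluded, so that J determines s. *)
Definition has_jordan_blocks (n : nat) (s : seq (F * nat)) (J : 'M[F]_n) : Prop :=
  all (fun b => 0 < b.2)%N s /\
  exists e : sumn [seq b.2 | b <- s] = n, J = castmx (e, e) (jordan_mx s).

Definition is_jordan_matrix (n : nat) (J : 'M[F]_n) : Prop :=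
  exists s : seq (F * nat), has_jordan_blocks s J.

Definition jordan_form (n : nat) (A P J : 'M[F]_n) : Prop :=
  [/\ P \in unitmx, is_jordan_matrix J & A = P *m J *m invmx P].

End Jordan.

Definition is_bc_jordan_matrix (R : realType) (n : nat)
    (J : 'M[bicomplex R]_n) : Prop :=
  exists J1 J2 : 'M[R[i]]_n,
    [/\ is_jordan_matrix J1, is_jordan_matrix J2 & J = idem_mx J1 J2].

Definition bc_jordan_form (R : realType) (n : nat)
    (A P J : 'M[bicomplex R]_n) : Prop :=
  [/\ P \in unitmx, is_bc_jordan_matrix J & A = P *m J *m invmx P].

(* Main.v *)
Require Import Defs.
From HB Require Import structures.
From mathcomp Require Import all_boot all_order all_algebra.
From mathcomp Require Import reals complex.
From mathcomp Require Import ring.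

Set Implicit Arguments.
Unset Strict Implicit.
Unset Printing Implicit Defensive.

Import Order.TTheory GRing.Theory Num.Theory.
Local Open Scope ring_scope.

(** The map [zeta |-> (zeta_1, zeta_2)] is a ring isomorphism from the
    bicomplex numbers onto C x C.  Entrywise, [idem_mx] is therefore a ring
    isomorphism from pairs of complex matrices onto bicomplex matrices: it
    carries products to products and inverses to inverses ([idem_mxM],
    [invmx_idem]), so two complex factorizations [P_k J_k P_k^-1] combine into
    one bicomplex factorization, whose middle factor is a bicomplex Jordan
    matrix by definition ([bc_jordan_form_idem]).

    What remains concerns Jordan matrices over a field.  Exchanging two
    adjacent diagonal blocks is a change of basis by a block permutation
    matrix, and adjacent exchanges generate all rearrangements, so permuting
    the list of blocks stays in the similarity class ([jordan_form_perm]).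
    Conversely a Jordan matrix determines the list of its blocks: the top left
    entry is the first eigenvalue, the first zero on the superdiagonal (if any)
    marks the end of the first block, and the rest is read from the complementary
    diagonal block ([jordan_blocks_uniq]).  As the idempotent components of a
    bicomplex matrix are unique, different arrangements give different
    bicomplex Jordan matrices.  In size at least 2, a matrix with one block of
    size 1 for the eigenvalue 0 and one block for the eigenvalue 1 has two
    arrangements, so non-uniqueness does occur. *)

(** * Inverses of matrices *)

Lemma mulmx1_invmx (R : comUnitRingType) (n : nat) (P Q : 'M[R]_n) :
  P *m Q = 1%:M -> invmx P = Q.
Proof.
move=> PQ; have [uP _] := mulmx1_unit PQ.
by rewrite -[LHS]mulmx1 -PQ mulKmx.
Qed.

(** * The idempotent decomposition is multiplicative *)

Lemma bc_idem1_zmod (R : realType) : zmod_morphism (@bc_idem1 R).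
Proof. by move=> x y; rewrite /bc_idem1 /=; ring. Qed.

Lemma bc_idem2_zmod (R : realType) : zmod_morphism (@bc_idem2 R).
Proof. by move=> x y; rewrite /bc_idem2 /=; ring. Qed.

Lemma bc_idem1_monoid (R : realType) : monoid_morphism (@bc_idem1 R).
Proof.
have ii : ('i%C : R[i]) ^+ 2 = -1 by rewrite sqr_i.
split=> [|x y]; rewrite /bc_idem1 /=; first by ring.
by ring: ii.
Qed.

Lemma bc_idem2_monoid (R : realType) : monoid_morphism (@bc_idem2 R).
Proof.
have ii : ('i%C : R[i]) ^+ 2 = -1 by rewrite sqr_i.
split=> [|x y]; rewrite /bc_idem2 /=; first by ring.
by ring: ii.
Qed.

HB.instance Definition _ (R : realType) :=
  GRing.isZmodMorphism.Build (bicomplex R) R[i] (@bc_idem1 R)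
    (@bc_idem1_zmod R).
HB.instance Definition _ (R : realType) :=
  GRing.isMonoidMorphism.Build (bicomplex R) R[i] (@bc_idem1 R)
    (@bc_idem1_monoid R).
HB.instance Definition _ (R : realType) :=
  GRing.isZmodMorphism.Build (bicomplex R) R[i] (@bc_idem2 R)
    (@bc_idem2_zmod R).
HB.instance Definition _ (R : realType) :=
  GRing.isMonoidMorphism.Build (bicomplex R) R[i] (@bc_idem2 R)
    (@bc_idem2_monoid R).

Lemma map_idem1_mx (R : realType) (m n : nat) (A1 A2 : 'M[R[i]]_(m, n)) :
  map_mx (@bc_idem1 R) (idem_mx A1 A2) = A1.
Proof. by apply/matrixP => i j; rewrite !mxE bc_idemK1. Qed.

Lemma map_idem2_mx (R : realType) (m n : nat) (A1 A2 : 'M[R[i]]_(m, n)) :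
  map_mx (@bc_idem2 R) (idem_mx A1 A2) = A2.
Proof. by apply/matrixP => i j; rewrite !mxE bc_idemK2. Qed.

(** Both sides have the same two idempotent components, because taking a
    component is a ring morphism. *)
Lemma idem_mxM (R : realType) (m n p : nat)
    (A1 A2 : 'M[R[i]]_(m, n)) (B1 B2 : 'M[R[i]]_(n, p)) :
  idem_mx A1 A2 *m idem_mx B1 B2 = idem_mx (A1 *m B1) (A2 *m B2).
Proof. by rewrite [LHS]idem_mxE !map_mxM !map_idem1_mx !map_idem2_mx. Qed.

Lemma idem_mx1 (R : realType) (n : nat) :
  idem_mx 1%:M 1%:M = 1%:M :> 'M[bicomplex R]_n.
Proof. by rewrite [RHS]idem_mxE !map_mx1. Qed.

Lemma idem_mx_mulmxV (R : realType) (n : nat) (P1 P2 : 'M[R[i]]_n) :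
  P1 \in unitmx -> P2 \in unitmx ->
  idem_mx P1 P2 *m idem_mx (invmx P1) (invmx P2) = 1%:M.
Proof. by move=> u1 u2; rewrite idem_mxM !mulmxV // idem_mx1. Qed.

Lemma unitmx_idem (R : realType) (n : nat) (P1 P2 : 'M[R[i]]_n) :
  P1 \in unitmx -> P2 \in unitmx -> idem_mx P1 P2 \in unitmx.
Proof.
by move=> u1 u2; have [uP _] := mulmx1_unit (idem_mx_mulmxV u1 u2).
Qed.

Lemma invmx_idem (R : realType) (n : nat) (P1 P2 : 'M[R[i]]_n) :
  P1 \in unitmx -> P2 \in unitmx ->
  invmx (idem_mx P1 P2) = idem_mx (invmx P1) (invmx P2).
Proof. by move=> u1 u2; apply/mulmx1_invmx/idem_mx_mulmxV. Qed.

Lemma bc_jordan_form_idem (R : realType) (n : nat)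
    (A1 A2 P1 J1 P2 J2 : 'M[R[i]]_n) :
  jordan_form A1 P1 J1 -> jordan_form A2 P2 J2 ->
  bc_jordan_form (idem_mx A1 A2) (idem_mx P1 P2) (idem_mx J1 J2).
Proof.
move=> [u1 jJ1 ->] [u2 jJ2 ->]; split.
- exact: unitmx_idem.
- by exists J1, J2.
- by rewrite invmx_idem // !idem_mxM.
Qed.

(** * Rearranging diagonal blocks *)

(** The two matrices may have sizes that are only provably equal, as happens
    for Jordan matrices of permuted block lists; rectangular conjugators [U]
    and [V] keep casts out of the block computations. *)
Definition similar (F : fieldType) (m n : nat) (A : 'M[F]_m) (B : 'M[F]_n) :=
  exists (U : 'M[F]_(m, n)) (V : 'M[F]_(n, m)),
    [/\ U *m V = 1%:M, V *m U = 1%:M & A = U *m B *m V].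

Lemma similar_refl (F : fieldType) (n : nat) (A : 'M[F]_n) : similar A A.
Proof. by exists 1%:M, 1%:M; rewrite !mulmx1 mul1mx. Qed.

Lemma similar_trans (F : fieldType) (m n p : nat)
    (A : 'M[F]_m) (B : 'M[F]_n) (C : 'M[F]_p) :
  similar A B -> similar B C -> similar A C.
Proof.
move=> [U [V [UV VU ->]]] [W [X [WX XW ->]]]; exists (U *m W), (X *m V); split.
- by rewrite mulmxA -(mulmxA U) WX mulmx1.
- by rewrite mulmxA -(mulmxA X) VU mulmx1.
- by rewrite !mulmxA.
Qed.

Lemma similar_cast (F : fieldType) (m n : nat) (e : m = n) (A : 'M[F]_m) :
  similar A (castmx (e, e) A).
Proof. by case: n / e; rewrite castmx_id; exact: similar_refl. Qed.

Lemma similar_block (F : fieldType) (k m n : nat)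
    (A : 'M[F]_k) (B : 'M[F]_m) (C : 'M[F]_n) :
  similar B C -> similar (block_mx A 0 0 B) (block_mx A 0 0 C).
Proof.
move=> [U [V [UV VU ->]]]; exists (block_mx 1%:M 0 0 U), (block_mx 1%:M 0 0 V).
by rewrite !mulmx_block !(mul0mx, mulmx0, mul1mx, mulmx1, addr0, add0r) UV VU
  -!scalar_mx_block.
Qed.

(** Conjugation by the permutation matrix that exchanges the first two groups
    of coordinates. *)
Lemma similar_swap (F : fieldType) (k l m : nat)
    (A : 'M[F]_k) (B : 'M[F]_l) (C : 'M[F]_m) :
  similar (block_mx A 0 0 (block_mx B 0 0 C))
          (block_mx B 0 0 (block_mx A 0 0 C)).
Proof.
pose S p q : 'M[F]_(p + (q + m), q + (p + m)) :=
  block_mx 0 (row_mx 1%:M 0) (col_mx 1%:M 0) (block_mx 0 0 0 1%:M).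
have SS p q : S p q *m S q p = 1%:M.
  rewrite /S mulmx_block mul_row_col mul_mx_row mul_row_block mul_col_mx.
  rewrite mul_block_col mul_col_row mulmx_block.
  rewrite !(mul0mx, mulmx0, mul1mx, mulmx1, addr0, add0r).
  rewrite row_mx0 col_mx0 add_block_mx !(addr0, add0r).
  by rewrite -!scalar_mx_block.
exists (S k l), (S l k); split; try exact: SS.
rewrite /S !mulmx_block.
rewrite !(mul0mx, mulmx0, mul1mx, mulmx1, addr0, add0r, mul_row_block,
  mul_col_mx, mul_row_col, mul_mx_row, mul_block_col, mul_col_row, mulmx_block,
  row_mx0, col_mx0, add_block_mx).
(* The lower right corner appears as a sum of two partial block matrices. *)
congr (block_mx _ _ _ _); rewrite -[X in row_mx _ X]col_mx0 -block_mxEh.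
rewrite -[X in col_mx X _]row_mx0 -block_mxEv add_block_mx.
by rewrite !(addr0, add0r).
Qed.

(** Moving the head block past [s], one exchange of neighbours at a time. *)
Lemma similar_jordan_insert (F : fieldType) (b : F * nat) (s t : seq (F * nat)) :
  similar (jordan_mx (b :: s ++ t)) (jordan_mx (s ++ b :: t)).
Proof.
elim: s => [|c s IH] /=; first exact: similar_refl.
exact: similar_trans (similar_swap _ _ _) (similar_block _ IH).
Qed.

Lemma similar_jordan_perm (F : fieldType) (s t : seq (F * nat)) :
  perm_eq s t -> similar (jordan_mx s) (jordan_mx t).
Proof.
elim: s t => [|b s IH] t.
  by rewrite perm_sym => /perm_nilP ->; exact: similar_refl.
move=> pst; have tb: b \in t by rewrite -(perm_mem pst) mem_head.
case/splitPr: tb pst => t1 t2 pst.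
apply: similar_trans (similar_jordan_insert b t1 t2).
apply: similar_block; apply: IH.
by move: pst; rewrite perm_sym perm_catC /= perm_cons perm_catC perm_sym.
Qed.

Lemma jordan_form_perm (F : fieldType) (n : nat) (A P J : 'M[F]_n)
    (s t : seq (F * nat)) :
  jordan_form A P J -> has_jordan_blocks s J -> perm_eq s t ->
  exists Q K : 'M[F]_n, jordan_form A Q K /\ has_jordan_blocks t K.
Proof.
move=> [uP _ ->] [s_gt0 [es ->]] pst.
have et : sumn [seq b.2 | b <- t] = n.
  by rewrite -es; apply/esym/perm_sumn/perm_map.
have t_gt0 : all (fun b => 0 < b.2)%N t by rewrite -(perm_all _ pst).
have [U [V [UV VU ->]]] :
    similar (castmx (es, es) (jordan_mx s)) (castmx (et, et) (jordan_mx t)).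
  apply: similar_trans (similar_cast et _).
  apply: similar_trans (similar_jordan_perm pst).
  by case: n / es {et uP A P J}; rewrite castmx_id; exact: similar_refl.
have jK : has_jordan_blocks t (castmx (et, et) (jordan_mx t)).
  by split=> //; exists et.
exists (P *m U), (castmx (et, et) (jordan_mx t)); split=> //; split.
- by have [uU _] := mulmx1_unit UV; rewrite unitmx_mul uP.
- by exists t.
- rewrite (@mulmx1_invmx _ _ (P *m U) (V *m invmx P)) ?mulmxA //.
  by rewrite -(mulmxA P) UV mulmx1 mulmxV.
Qed.

(** * A Jordan matrix determines the list of its blocks *)

(** If the first block of the left matrix ended strictly inside the first
    block of the right one, the superdiagonal entry at the end of the former
    would be 0 on the left and 1 on the right. *)
Lemma jordan_head_size_le (F : fieldType) (b c : F * nat)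
    (s t : seq (F * nat))
    (e : sumn [seq d.2 | d <- b :: s] = sumn [seq d.2 | d <- c :: t]) :
  (0 < b.2)%N -> castmx (e, e) (jordan_mx (b :: s)) = jordan_mx (c :: t) ->
  (c.2 <= b.2)%N.
Proof.
move=> b_gt0 /matrixP E; rewrite leqNgt; apply/negP => lt_bc.
have lt_b1c : (b.2.-1 < c.2)%N by rewrite prednK // ltnW.
have lt_b1b : (b.2.-1 < b.2)%N by rewrite prednK.
have s_gt0 : (0 < sumn [seq d.2 | d <- s])%N.
  rewrite -(ltn_add2l b.2) addn0; have /= -> := e.
  exact: leq_trans lt_bc (leq_addr _ _).
move: (E (lshift _ (Ordinal lt_b1c)) (lshift _ (Ordinal lt_bc))).
rewrite castmxE.
have -> : cast_ord (esym e) (lshift _ (Ordinal lt_b1c))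
    = lshift _ (Ordinal lt_b1b) by exact: val_inj.
have -> : cast_ord (esym e) (lshift _ (Ordinal lt_bc))
    = rshift _ (Ordinal s_gt0) by apply: val_inj; rewrite /= addn0.
rewrite [LHS]block_mxEur [RHS]block_mxEul !mxE -val_eqE /= prednK //.
by rewrite ltn_eqF // eqxx => /esym/eqP; rewrite oner_eq0.
Qed.

Lemma jordan_head_eigenvalue (F : fieldType) (b c : F * nat)
    (s t : seq (F * nat))
    (e : sumn [seq d.2 | d <- b :: s] = sumn [seq d.2 | d <- c :: t]) :
  (0 < b.2)%N -> (0 < c.2)%N ->
  castmx (e, e) (jordan_mx (b :: s)) = jordan_mx (c :: t) -> b.1 = c.1.
Proof.
move=> b_gt0 c_gt0 /matrixP E.
move: (E (lshift _ (Ordinal c_gt0)) (lshift _ (Ordinal c_gt0))).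
rewrite castmxE.
have -> : cast_ord (esym e) (lshift _ (Ordinal c_gt0))
    = lshift _ (Ordinal b_gt0) by exact: val_inj.
by rewrite [LHS]block_mxEul [RHS]block_mxEul !mxE !eqxx.
Qed.

Lemma cast_block_mx_inj (F : fieldType) (k m n : nat) (A : 'M[F]_k)
    (B : 'M[F]_m) (C : 'M[F]_n) (e : (k + m = k + n)%N) :
  castmx (e, e) (block_mx A 0 0 B) = block_mx A 0 0 C ->
  exists e' : m = n, castmx (e', e') B = C.
Proof.
have e' := addnI e; move: C e; case: n / e' => C e.
by rewrite castmx_id => /eq_block_mx[_ _ _ ->]; exists erefl.
Qed.

Lemma jordan_mx_inj (F : fieldType) (s t : seq (F * nat))
    (e : sumn [seq b.2 | b <- s] = sumn [seq b.2 | b <- t]) :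
  all (fun b => 0 < b.2)%N s -> all (fun b => 0 < b.2)%N t ->
  castmx (e, e) (jordan_mx s) = jordan_mx t -> s = t.
Proof.
elim: s t e => [|b s IH] [|c t] e //=.
(* Blocks of positive size cannot add up to size 0. *)
- by move: e; case: c => a [|k].
- by move: e; case: b => a [|k].
move=> /andP[b_gt0 s_gt0] /andP[c_gt0 t_gt0] E.
have E' : castmx (esym e, esym e) (jordan_mx (c :: t)) = jordan_mx (b :: s).
  by rewrite -[jordan_mx (c :: t)]E castmxK.
have eq2 : b.2 = c.2.
  apply/eqP; rewrite eqn_leq (jordan_head_size_le b_gt0 E).
  by rewrite (jordan_head_size_le c_gt0 E').
have eq1 := jordan_head_eigenvalue b_gt0 c_gt0 E.
have ebc : b = c by apply/eqP; rewrite -pair_eqE /pair_eq eq1 eq2 !eqxx.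
move: e E {eq1 eq2 E'}; case: c / ebc {c_gt0} => e E.
by have [e' /IH ->] := cast_block_mx_inj E.
Qed.

Lemma jordan_blocks_uniq (F : fieldType) (n : nat) (J : 'M[F]_n)
    (s t : seq (F * nat)) :
  has_jordan_blocks s J -> has_jordan_blocks t J -> s = t.
Proof.
move=> [s_gt0 [es ->]] [t_gt0 [et]]; case: n / et es {J} => es.
by rewrite castmx_id; exact: jordan_mx_inj.
Qed.

Lemma idem_mx_jordan_neq (R : realType) (n : nat)
    (t1 t2 u1 u2 : seq (R[i] * nat)) (K1 K2 L1 L2 : 'M[R[i]]_n) :
  has_jordan_blocks t1 K1 -> has_jordan_blocks t2 K2 ->
  has_jordan_blocks u1 L1 -> has_jordan_blocks u2 L2 ->
  (t1, t2) <> (u1, u2) -> idem_mx K1 K2 <> idem_mx L1 L2.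
Proof.
move=> hK1 hK2 hL1 hL2 neq /idem_mx_inj[e1 e2]; apply: neq.
rewrite -e1 in hL1; rewrite -e2 in hL2.
by rewrite (jordan_blocks_uniq hK1 hL1) (jordan_blocks_uniq hK2 hL2).
Qed.

(** The witness has blocks of sizes 1 and [n - 1]; the eigenvalues 0 and 1
    keep the two arrangements distinct even when these sizes agree. *)
Lemma jordan_form_not_unique (F : fieldType) (n : nat) : (1 < n)%N ->
  exists (B P Q J K : 'M[F]_n) (s t : seq (F * nat)),
    [/\ jordan_form B P J, jordan_form B Q K,
        has_jordan_blocks s J, has_jordan_blocks t K & s <> t].
Proof.
case: n => [|[|m]] // _.
pose s : seq (F * nat) := [:: (0, 1%N); (1, m.+1)].
pose t : seq (F * nat) := [:: (1, m.+1); (0, 1%N)].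
have es : sumn [seq b.2 | b <- s] = m.+2 by rewrite /= addn0.
pose J := castmx (es, es) (jordan_mx s).
have hJ : has_jordan_blocks s J by split=> //; exists es.
have fJ : jordan_form J 1%:M J.
  by split; [exact: unitmx1 | exists s | rewrite invmx1 mul1mx mulmx1].
have pst : perm_eq s t by rewrite /s -[_ :: _]/([:: _] ++ [:: _]) perm_catC.
have [Q [K [fK hK]]] := jordan_form_perm fJ hJ pst.
exists J, 1%:M, Q, J, K, s, t; split=> //.
by case=> /eqP; rewrite eq_sym oner_eq0.
Qed.

(** * Jordan forms of bicomplex matrices *)

Theorem theorem2 (R : realType) (n : nat) (A : 'M[bicomplex R]_n)
    (A1 A2 P1 J1 P2 J2 : 'M[R[i]]_n)
    (defA : A = idem_mx A1 A2)
    (jordanA1 : jordan_form A1 P1 J1)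
    (jordanA2 : jordan_form A2 P2 J2) :
  [/\ (* the combined factorization is a bicomplex Jordan form of A *)
      bc_jordan_form A (idem_mx P1 P2) (idem_mx J1 J2),
      (* the blocks of J1 and of J2 may be put, independently, in any order *)
      forall s1 s2 t1 t2 : seq (R[i] * nat),
        has_jordan_blocks s1 J1 -> has_jordan_blocks s2 J2 ->
        perm_eq s1 t1 -> perm_eq s2 t2 ->
        exists Q1 K1 Q2 K2 : 'M[R[i]]_n,
          [/\ jordan_form A1 Q1 K1 /\ has_jordan_blocks t1 K1,
              jordan_form A2 Q2 K2 /\ has_jordan_blocks t2 K2
            & bc_jordan_form A (idem_mx Q1 Q2) (idem_mx K1 K2)],
      (* different arrangements of blocks give different bicomplex forms *)
      forall (t1 t2 u1 u2 : seq (R[i] * nat)) (K1 K2 L1 L2 : 'M[R[i]]_n),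
        has_jordan_blocks t1 K1 -> has_jordan_blocks t2 K2 ->
        has_jordan_blocks u1 L1 -> has_jordan_blocks u2 L2 ->
        (t1, t2) <> (u1, u2) -> idem_mx K1 K2 <> idem_mx L1 L2
    & (* non-uniqueness does occur, over the complex and bicomplex numbers *)
      (1 < n)%N ->
        (exists B P J Q K : 'M[R[i]]_n,
          [/\ jordan_form B P J, jordan_form B Q K & J <> K]) /\
        (exists B P J Q K : 'M[bicomplex R]_n,
          [/\ bc_jordan_form B P J, bc_jordan_form B Q K & J <> K])].
Proof.
rewrite defA; split.
- exact: bc_jordan_form_idem.
- move=> s1 s2 t1 t2 hJ1 hJ2 p1 p2.
  have [Q1 [K1 [f1 h1]]] := jordan_form_perm jordanA1 hJ1 p1.
  have [Q2 [K2 [f2 h2]]] := jordan_form_perm jordanA2 hJ2 p2.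
  by exists Q1, K1, Q2, K2; split=> //; exact: bc_jordan_form_idem.
- exact: idem_mx_jordan_neq.
- move=> n_gt1.
  have [B [P [Q [J [K [s [t [fJ fK hJ hK neq]]]]]]]] :=
    jordan_form_not_unique R[i] n_gt1.
  split.
    exists B, P, J, Q, K; split=> // eJK; apply: neq.
    by rewrite -eJK in hK; exact: jordan_blocks_uniq hJ hK.
  exists (idem_mx B B), (idem_mx P P), (idem_mx J J), (idem_mx Q Q),
    (idem_mx K K).
  split; try exact: bc_jordan_form_idem.
  by apply: (idem_mx_jordan_neq hJ hJ hK hK) => -[].
Qed.
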